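(* Let $D$ be an additively idempotent division semiring. Then the class of injective left $D$-semimodules is a proper subclass of the class of e-injective left $D$-semimodules; that is, every injective left $D$-semimodule is e-injective, and there exists an e-injective left $D$-semimodule that is not injective.
   Context: A semiring is $(S,+,\cdot,0,1)$ with $(S,+,0)$ a commutative monoid, $(S,\cdot,1)$ a monoid, multiplication distributing over addition on both sides, and $0s=0=s0$ for all $s$. It is a division semiring if $(S\setminus\{0\},\cdot,1)$ is a group, and additively idempotent if $s+s=s$ for all $s\in S$. A left $S$-semimodule is a commutative monoid $(M,+,0)$ with a scalar multiplication $S\times M\to M$ satisfying $(ss')m=s(s'm)$, $s(m+m')=sm+sm'$, $(s+s')m=sm+s'm$, $1m=m$, $s0=0=0m$. Homomorphisms preserve $+$, $0$ and scalar multiplication; ${}_S\mathcal{M}$ is the category of left $S$-semimodules and $\mathcal{M}$ the category of commutative monoids. $M\in{}_S\mathcal{M}$ is injective if for every injective homomorphism $\mu:A\to B$ in ${}_S\mathcal{M}$ and every homomorphism $f:A\to M$ there is a homomorphism $\tilde f:B\to M$ with $\tilde f\mu=f$. A sequence $0\to A\xrightarrow{f}B\xrightarrow{g}C\to 0$ in ${}_S\mathcal{M}$ (or in $\mathcal{M}$) is short exact if $f$ is a categorical kernel of $g$ and $g$ is a categorical cokernel of $f$ (kernels and cokernels in the sense of categories with zero morphisms). $M\in{}_S\mathcal{M}$ is e-injective if the contravariant functor $\mathrm{Hom}_S(-,M):{}_S\mathcal{M}\to\mathcal{M}$ sends every short exact sequence $0\to A\to B\to C\to 0$ to a short exact sequence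 $0\to\mathrm{Hom}_S(C,M)\to\mathrm{Hom}_S(B,M)\to\mathrm{Hom}_S(A,M)\to 0$ in $\mathcal{M}$. *)

(* Defs.v *)
From HB Require Import structures.
From mathcomp Require Import all_boot all_algebra boolp.

Set Implicit Arguments.
Unset Strict Implicit.
Unset Printing Implicit Defensive.

Import GRing.Theory.
Local Open Scope ring_scope.

Definition division_semiring (D : pzSemiRingType) : Prop :=
  [/\ (1 : D) != 0,
      forall a b : D, a != 0 -> b != 0 -> a * b != 0
    & forall a : D, a != 0 -> exists2 b : D, b != 0 & b * a = 1 /\ a * b = 1].

(* Equality of morphisms is pointwise equality [=1] throughout. *)
Section Semimodules.
Variable S : pzSemiRingType.

Definition is_kernel (A B C : lSemiModType S)
    (f : {linear A -> B}) (g : {linear B -> C}) : Prop :=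
  g \o f =1 \0 /\
  forall (X : lSemiModType S) (h : {linear X -> B}), g \o h =1 \0 ->
    exists2 k : {linear X -> A}, f \o k =1 h &
      forall k' : {linear X -> A}, f \o k' =1 h -> k' =1 k.

Definition is_cokernel (A B C : lSemiModType S)
    (f : {linear A -> B}) (g : {linear B -> C}) : Prop :=
  g \o f =1 \0 /\
  forall (X : lSemiModType S) (h : {linear B -> X}), h \o f =1 \0 ->
    exists2 k : {linear C -> X}, k \o g =1 h &
      forall k' : {linear C -> X}, k' \o g =1 h -> k' =1 k.

Definition short_exact (A B C : lSemiModType S)
    (f : {linear A -> B}) (g : {linear B -> C}) : Prop :=
  is_kernel f g /\ is_cokernel f g.

Definition injective_semimodule (M : lSemiModType S) : Prop :=
  forall (A B : lSemiModType S) (mu : {linear A -> B}) (f : {linear A -> M}),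
    injective mu -> exists ft : {linear B -> M}, ft \o mu =1 f.

End Semimodules.

Definition is_mkernel (A B C : nmodType)
    (f : {additive A -> B}) (g : {additive B -> C}) : Prop :=
  g \o f =1 \0 /\
  forall (X : nmodType) (h : {additive X -> B}), g \o h =1 \0 ->
    exists2 k : {additive X -> A}, f \o k =1 h &
      forall k' : {additive X -> A}, f \o k' =1 h -> k' =1 k.

Definition is_mcokernel (A B C : nmodType)
    (f : {additive A -> B}) (g : {additive B -> C}) : Prop :=
  g \o f =1 \0 /\
  forall (X : nmodType) (h : {additive B -> X}), h \o f =1 \0 ->
    exists2 k : {additive C -> X}, k \o g =1 h &
      forall k' : {additive C -> X}, k' \o g =1 h -> k' =1 k.

Definition short_mexact (A B C : nmodType)
    (f : {additive A -> B}) (g : {additive B -> C}) : Prop :=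
  is_mkernel f g /\ is_mcokernel f g.

Section Hom.
Variable S : pzSemiRingType.

(* An alias of the type of linear maps, carrying the pointwise commutative
   monoid structure (no lSemiModType structure, S not being commutative). *)
Definition hom_monoid (A M : lSemiModType S) : Type := {linear A -> M}.

Section HomMonoid.
Variables A M : lSemiModType S.

HB.instance Definition _ := gen_eqMixin (hom_monoid A M).
HB.instance Definition _ := gen_choiceMixin (hom_monoid A M).

Lemma hom_eqP (f g : {linear A -> M}) : f =1 g -> f = g.
Proof.
case: f g => [f [[f0] [fZ]]] [g [[g0] [gZ]]] /= fg.
have {}fg : f = g by apply: funext.
by subst g; congr (GRing.Linear.Pack (GRing.Linear.Class _ _));
  congr (_ _); exact: Prop_irrelevance.
Qed.

Definition hom_zero : hom_monoid A M := (\0 : A -> M) : {linear A -> M}.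
Definition hom_add (f g : hom_monoid A M) : hom_monoid A M :=
  ((f : {linear A -> M}) \+ (g : {linear A -> M})) : {linear A -> M}.

Fact hom_addA : associative hom_add.
Proof. by move=> f g h; apply: hom_eqP => x; exact: addrA. Qed.
Fact hom_addC : commutative hom_add.
Proof. by move=> f g; apply: hom_eqP => x; exact: addrC. Qed.
Fact hom_add0 : left_id hom_zero hom_add.
Proof. by move=> f; apply: hom_eqP => x; exact: add0r. Qed.

HB.instance Definition _ :=
  GRing.isNmodule.Build (hom_monoid A M) hom_addA hom_addC hom_add0.

End HomMonoid.

Section Precomposition.
Variables (A B M : lSemiModType S) (f : {linear A -> B}).

(* The image of f under the contravariant functor Hom(-, M). *)
Definition precomp (phi : hom_monoid B M) : hom_monoid A M :=
  ((phi : {linear B -> M}) \o f) : {linear A -> M}.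

Fact precomp_is_nmod_morphism : nmod_morphism precomp.
Proof. by split=> [|phi psi]; apply: hom_eqP. Qed.

HB.instance Definition _ :=
  GRing.isNmodMorphism.Build (hom_monoid B M) (hom_monoid A M) precomp
    precomp_is_nmod_morphism.

End Precomposition.

Definition e_injective (M : lSemiModType S) : Prop :=
  forall (A B C : lSemiModType S) (f : {linear A -> B}) (g : {linear B -> C}),
    short_exact f g -> short_mexact (precomp (M := M) g) (precomp (M := M) f).

End Hom.

(* Main.v *)
Require Import Defs.
From HB Require Import structures.
From mathcomp Require Import all_boot all_algebra boolp.

(** Every semimodule over [D] is a join-semilattice on which each nonzero scalar
    acts by automorphisms, so a greatest element is fixed by all of them, and in
    a short exact sequence [0 -> A -> B -> C -> 0] the image of [A] is a
    down-closed set whose complement is stable under nonzero scalars. If [M] has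
    a greatest element, a map on [A] therefore extends to [B] by sending
    everything outside [A] to that element, and adding the map to [M] that is
    [0] on [A] and greatest outside identifies any two extensions: having a
    greatest element implies e-injectivity. An injective [M] has one, as a
    retract of [M] with a greatest element adjoined. The five element
    nondistributive lattice M3, with nonzero scalars acting trivially, has one
    too but is not injective, since it is not a retract of a Boolean lattice. *)

Set Implicit Arguments.
Unset Strict Implicit.
Unset Printing Implicit Defensive.

Import GRing.Theory.
Local Open Scope ring_scope.

Definition linear_of (S : pzSemiRingType) (U V : lSemiModType S) (f : U -> V)
    (f_semilinear : semilinear f) : {linear U -> V} :=
  HB.pack f (GRing.isSemilinear.Build S U V *:%R f f_semilinear).

Definition additive_of (U V : nmodType) (f : U -> V)
    (f_additive : nmod_morphism f) : {additive U -> V} :=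
  HB.pack f (GRing.isNmodMorphism.Build U V f f_additive).

(** * Kernels and cokernels of semimodules in terms of elements *)

Section Elements.
Variables (S : pzSemiRingType).

Fact line_semilinear (M : lSemiModType S) (m : M) :
  semilinear (fun s : S^o => (s : S) *: m).
Proof. by split=> [a s | s t]; rewrite ?scalerA // scalerDl. Qed.

(** The universal property is tested on the free semimodule [S^o], whose maps pick out single
    elements: uniqueness gives injectivity, existence gives preimages of the zeros of [g]. *)
Lemma is_kernelP (A B C : lSemiModType S)
    (f : {linear A -> B}) (g : {linear B -> C}) : is_kernel f g ->
  injective f /\ forall b, g b = 0 -> exists a, f a = b.
Proof.
case=> gf0 ker_univ; split=> [a a' faa' | b gb0].
  pose h := linear_of (line_semilinear (f a)).
  have gh0 : g \o h =1 \0.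
    by move=> s /=; rewrite linearZ_LR [g (f a)]gf0 scaler0.
  have [k _ k_uniq] := ker_univ _ h gh0.
  pose l (x : A) := linear_of (line_semilinear x).
  have /k_uniq/(_ 1) /= : f \o l a =1 h by move=> s /=; rewrite linearZ_LR.
  have /k_uniq/(_ 1) /= : f \o l a' =1 h by move=> s /=; rewrite linearZ_LR faa'.
  by rewrite !scale1r => -> ->.
pose h := linear_of (line_semilinear b).
have gh0 : g \o h =1 \0 by move=> s /=; rewrite linearZ_LR gb0 scaler0.
have [k fk _] := ker_univ _ h gh0.
by exists (k 1); have := fk 1 => /= ->; rewrite scale1r.
Qed.

Lemma is_cokernel_epi (A B C X : lSemiModType S)
    (f : {linear A -> B}) (g : {linear B -> C}) (k k' : {linear C -> X}) :
  is_cokernel f g -> k \o g =1 k' \o g -> k =1 k'.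
Proof.
case=> gf0 coker_univ kk' c.
have [|k0 _ k0_uniq] := coker_univ X (k \o g).
  by move=> a /=; have /= -> := gf0 a; rewrite linear0.
by rewrite (k0_uniq k) // (k0_uniq k') // => b; rewrite -kk'.
Qed.

Lemma precomp_is_mkernel (A B C M : lSemiModType S)
    (f : {linear A -> B}) (g : {linear B -> C}) : is_cokernel f g ->
  is_mkernel (precomp (M := M) g) (precomp (M := M) f).
Proof.
move=> gcok; have [gf0 coker_univ] := gcok; split=> [phi | X h fh0].
  by apply: hom_eqP => a /=; have /= -> := gf0 a; rewrite linear0.
(* Each [h x] factors through [g] separately; the chosen factors depend additively on [x] because
   [g] is epi. *)
have /choice [k kP] (x : X) :
    exists k : {linear C -> M}, k \o g =1 (h x : {linear B -> M}).
  have [a | k kg _] := coker_univ M (h x); last by exists k.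
  by have /(congr1 (fun u : {linear A -> M} => u a)) := fh0 x.
pose k1 (x : X) : hom_monoid C M := k x.
have k_additive : nmod_morphism k1.
  split=> [|x y]; apply: hom_eqP; apply: (is_cokernel_epi gcok) => b.
    by rewrite (kP 0) raddf0.
  rewrite (kP (x + y)) raddfD /=.
  by rewrite -[h x b]kP -[h y b]kP.
exists (additive_of k_additive) => [x | k' k'P x].
  by apply: hom_eqP => b; apply: kP.
apply: hom_eqP; apply: (is_cokernel_epi gcok) => b.
by rewrite kP -k'P.
Qed.

End Elements.

Section DivisionSemiring.
Variable D : pzSemiRingType.
Hypotheses (D_division : division_semiring D) (D_idem : forall s : D, s + s = s).

Lemma semimod_addrr (M : lSemiModType D) (m : M) : m + m = m.
Proof. by rewrite -{1 2}[m]scale1r -scalerDl D_idem scale1r. Qed.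

Lemma idem_addr_eq0 (L : nmodType) :
  (forall x : L, x + x = x) ->
  forall x y : L, (x + y == 0) = (x == 0) && (y == 0).
Proof.
move=> L_idem x y; apply/eqP/andP=> [xy0 | [/eqP-> /eqP->]]; last exact: addr0.
have x0 : x = 0 by rewrite -[x]addr0 -xy0 addrA L_idem.
by move: xy0; rewrite x0 add0r => ->.
Qed.

Lemma semimod_addr_eq0 (M : lSemiModType D) (m n : M) :
  (m + n == 0) = (m == 0) && (n == 0).
Proof. by apply: idem_addr_eq0; apply: semimod_addrr. Qed.

Lemma semimod_scaler_eq0 (M : lSemiModType D) (d : D) (m : M) :
  (d *: m == 0) = (d == 0) || (m == 0).
Proof.
have [-> | d0] /= := eqVneq d 0; first by rewrite scale0r eqxx.
have [_ _ /(_ d d0) [e _ [ed _]]] := D_division.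
apply/eqP/eqP=> [dm0 | ->]; last exact: scaler0.
by rewrite -[m]scale1r -ed -scalerA dm0 scaler0.
Qed.

(** * A greatest element yields e-injectivity *)

Section Top.
Variables (M : lSemiModType D) (top : M).
Hypothesis add_top : forall m : M, m + top = top.

Lemma scale_top (d : D) : d != 0 -> d *: top = top.
Proof.
move=> d0; have [_ _ /(_ d d0) [e _ [_ de]]] := D_division.
(* With [e] inverse to [d], [top] is [d *: (e *: top)], which [d *: top] absorbs. *)
have <- : top + d *: top = d *: top.
  by rewrite -{1}(scale1r top) -de -scalerA -scalerDr add_top.
by rewrite addrC add_top.
Qed.

Definition extend_top (B C : lSemiModType D) (g : B -> C) (phi : B -> M) (b : B) :=
  if g b == 0 then phi b else top.

(** Outside the zeros of [g], nonzero scalars and adding any element stay outside, and [top] is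
    stable under both. So [phi] may be a bare function, linear only on those zeros. *)
Lemma extend_top_semilinear (B C : lSemiModType D) (g : {linear B -> C})
    (phi : B -> M) :
  (forall d b, g b = 0 -> phi (d *: b) = d *: phi b) ->
  (forall b b', g b = 0 -> g b' = 0 -> phi (b + b') = phi b + phi b') ->
  semilinear (extend_top g phi).
Proof.
rewrite /extend_top => phiZ phiD; split=> [d b | b b'].
  rewrite linearZ_LR semimod_scaler_eq0.
  have [gb0 | gb] := eqVneq (g b) 0; first by rewrite orbT phiZ.
  have [-> | d0] /= := eqVneq d 0; last by rewrite scale_top.
  rewrite !scale0r; have := phiZ 0 0; rewrite !scale0r => -> //.
  exact: linear0.
rewrite linearD semimod_addr_eq0.
have [gb0 | gb] /= := eqVneq (g b) 0; last by rewrite addrC add_top.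
by have [gb'0 | gb'] := eqVneq (g b') 0; rewrite ?phiD ?add_top.
Qed.

Lemma top_e_injective : e_injective M.
Proof.
move=> A B C f g [fker gcok]; split; first exact: precomp_is_mkernel.
have [f_inj ker_im] := is_kernelP fker; have [gf0 _] := gcok.
(* [p] inverts [f] on the zeros of [g]; its value 0 elsewhere is never read by [extend_top]. *)
have /choice [p pP] (b : B) : exists a, g b = 0 -> f a = b.
  have [/ker_im [a] | gb] := eqVneq (g b) 0; first by exists a.
  by exists 0 => /eqP; rewrite (negPf gb).
have pf a : p (f a) = a by apply: f_inj; apply: pP; apply: gf0.
have ext_semilinear (phi : {linear A -> M}) : semilinear (extend_top g (phi \o p)).
  apply: extend_top_semilinear => [d b gb0 | b b' gb0 gb'0] /=.
    by rewrite -[in LHS](pP b gb0) -linearZ_LR pf linearZ_LR.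
  by rewrite -[in LHS](pP b gb0) -[in LHS](pP b' gb'0) -linearD pf linearD.
pose ext (phi : hom_monoid A M) : hom_monoid B M := linear_of (ext_semilinear phi).
(* [alpha] sends 0 to 0 and all else to [top]. It measures how far [ext] is from preserving 0; a map
   killing [precomp g alpha] does not see the difference, so [h \o ext] is additive. *)
have alpha_semilinear : semilinear (extend_top (idfun : {linear C -> C}) (fun=> 0)).
  by apply: extend_top_semilinear => *; rewrite ?scaler0 ?addr0.
pose alpha : hom_monoid C M := linear_of alpha_semilinear.
have ext0 : ext 0 = precomp g alpha by apply: hom_eqP.
have extD phi psi : ext (phi + psi) = ext phi + ext psi.
  apply: hom_eqP => b; rewrite /= /extend_top.
  by case: ifP; rewrite ?add_top.
have ext_precomp phi : ext (precomp f phi) = phi + precomp g alpha.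
  apply: hom_eqP => b; rewrite /= /extend_top /=.
  by case: eqP => [/pP-> | _]; rewrite ?addr0 ?add_top.
have precomp_ext phi : precomp f (ext phi) = phi.
  by apply: hom_eqP => a; rewrite /= /extend_top [g _]gf0 eqxx /= pf.
split=> [phi | X h hg0].
  by apply: hom_eqP => a /=; have /= -> := gf0 a; rewrite linear0.
have ext_additive : nmod_morphism (h \o ext).
  split=> [|phi psi] /=; first by rewrite ext0; apply: hg0.
  by rewrite extD raddfD.
exists (additive_of ext_additive) => [phi | k' k'P phi] /=.
  by rewrite ext_precomp raddfD [h (precomp _ _)]hg0 addr0.
by rewrite -[in LHS](precomp_ext phi); apply: k'P.
Qed.

End Top.

(** * Adjoining a greatest element *)

Section AdjoinTop.
Variable M : lSemiModType D.

Definition with_top : Type := option M.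
HB.instance Definition _ := Choice.on with_top.

Definition with_top_add (x y : with_top) : with_top :=
  if x is Some m then if y is Some n then Some (m + n) else None else None.
Definition with_top_scale (d : D) (x : with_top) : with_top :=
  if x is Some m then Some (d *: m) else if d == 0 then Some 0 else None.

Fact with_top_addA : associative with_top_add.
Proof. by case=> [x|] [y|] [z|] //=; rewrite addrA. Qed.
Fact with_top_addC : commutative with_top_add.
Proof. by case=> [x|] [y|] //=; rewrite addrC. Qed.
Fact with_top_add0 : left_id (Some 0) with_top_add.
Proof. by case=> [x|] //=; rewrite add0r. Qed.

HB.instance Definition _ :=
  GRing.isNmodule.Build with_top with_top_addA with_top_addC with_top_add0.

Fact with_top_scaleA (a b : D) (x : with_top) :
  with_top_scale a (with_top_scale b x) = with_top_scale (a * b) x.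
Proof.
case: x => [m|] /=; first by rewrite scalerA.
have [-> | b0] := eqVneq b 0; first by rewrite mulr0 eqxx /= scaler0.
have [-> | a0] /= := eqVneq a 0; first by rewrite mul0r eqxx.
by have [_ Dmul _] := D_division; rewrite (negPf (Dmul _ _ a0 b0)) (negPf a0).
Qed.
Fact with_top_scale0 (x : with_top) : with_top_scale 0 x = 0.
Proof. by case: x => [m|] /=; rewrite ?scale0r ?eqxx. Qed.
Fact with_top_scale1 : left_id 1 with_top_scale.
Proof.
case=> [m|] /=; first by rewrite scale1r.
by have [/negPf->] := D_division.
Qed.
Fact with_top_scaleDr : right_distributive with_top_scale +%R.
Proof.
move=> d [m|] [n|]; rewrite /GRing.add /=; first by rewrite scalerDr.
all: by have [d0 | d0] := eqVneq d 0; rewrite /= ?d0 ?scale0r ?addr0 ?add0r.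
Qed.
Fact with_top_scaleDl (x : with_top) :
  {morph with_top_scale^~ x : a b / a + b}.
Proof.
move=> a b; case: x => [m|]; rewrite [RHS]/GRing.add /=; first by rewrite scalerDl.
(* On the adjoined top both sides agree because a sum in [D] vanishes only when both terms do. *)
rewrite (idem_addr_eq0 D_idem).
by have [|a0] := eqVneq a 0; have [|b0] //= := eqVneq b 0; rewrite addr0.
Qed.

HB.instance Definition _ :=
  GRing.Nmodule_isLSemiModule.Build D with_top with_top_scaleA with_top_scale0
    with_top_scale1 with_top_scaleDr with_top_scaleDl.

Fact Some_semilinear : semilinear (Some : M -> with_top).
Proof. by []. Qed.

Lemma injective_has_top : injective_semimodule M ->
  exists top : M, forall m, m + top = top.
Proof.
have Some_inj : injective (linear_of Some_semilinear) by move=> m n [].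
move=> /(_ _ _ _ idfun Some_inj) [r rP].
(* Since [r] fixes [m], [m + r None] is [r] of [Some m + None], that is [r None]. *)
exists (r None) => m.
by rewrite -{1}[m]rP /= -linearD.
Qed.

End AdjoinTop.

(** * Semilattices as semimodules with trivial action *)

Section BooleanSemimodule.
Variable L : nmodType.
Hypothesis L_idem : forall x : L, x + x = x.

(** The action through the semiring map from [D] to the Boolean semiring that sends every nonzero
    scalar to 1. *)
Definition boolean_scale (d : D) (x : L) : L := if d == 0 then 0 else x.

Fact boolean_scaleA a b x :
  boolean_scale a (boolean_scale b x) = boolean_scale (a * b) x.
Proof.
rewrite /boolean_scale.
have [-> | a0] := eqVneq a 0; first by rewrite mul0r eqxx.
have [-> | b0] := eqVneq b 0; first by rewrite mulr0 eqxx.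
by have [_ Dmul _] := D_division; rewrite (negPf (Dmul _ _ a0 b0)).
Qed.
Fact boolean_scale0 x : boolean_scale 0 x = 0.
Proof. by rewrite /boolean_scale eqxx. Qed.
Fact boolean_scale1 : left_id 1 boolean_scale.
Proof. by move=> x; rewrite /boolean_scale; have [/negPf->] := D_division. Qed.
Fact boolean_scaleDr : right_distributive boolean_scale +%R.
Proof. by move=> d x y; rewrite /boolean_scale; case: ifP; rewrite ?addr0. Qed.
Fact boolean_scaleDl x : {morph boolean_scale^~ x : a b / a + b}.
Proof.
move=> a b; rewrite /boolean_scale (idem_addr_eq0 D_idem).
by case: (a == 0); case: (b == 0); rewrite /= ?addr0 ?add0r ?L_idem.
Qed.

Definition boolean_semimodule : lSemiModType D :=
  HB.pack (GRing.Nmodule.sort L)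
    (GRing.Nmodule_isLSemiModule.Build D L boolean_scaleA boolean_scale0
       boolean_scale1 boolean_scaleDr boolean_scaleDl).

End BooleanSemimodule.

End DivisionSemiring.

(** * The lattice M3 inside the Boolean lattice of subsets *)

Definition join_set (T : finType) : Type := {set T}.
HB.instance Definition _ (T : finType) := Choice.on (join_set T).
HB.instance Definition _ (T : finType) :=
  GRing.isNmodule.Build (join_set T) (@setUA T) (@setUC T) (@set0U T).

Definition not_singleton (T : finType) : {pred join_set T} :=
  fun A => #|(A : {set T})| != 1%N.

Fact not_singleton_addr_closed (T : finType) : addr_closed (@not_singleton T).
Proof.
split=> [|A B]; first by rewrite unfold_in /not_singleton cards0.
rewrite !unfold_in /not_singleton => A1 B1; apply: contraNN A1.
case/cards1P=> x /= ABx.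
(* A part [A] of a singleton union has at most one element; were it empty, [B] would be the
   singleton. *)
rewrite eqn_leq -{1}(cards1 x) -{1}ABx subset_leq_card ?subsetUl //=.
rewrite card_gt0; apply: contraNneq B1 => A0.
by rewrite -(cards1 x) -ABx A0 [_ + _]set0U.
Qed.

(* For [T] of cardinal 3 this is M3: the empty set, three pairs, and [T]. *)
Record nonsingleton (T : finType) := Nonsingleton {
  nonsingleton_val :> join_set T; _ : nonsingleton_val \in @not_singleton T }.
HB.instance Definition _ (T : finType) := [isSub for @nonsingleton_val T].
HB.instance Definition _ (T : finType) := [Choice of nonsingleton T by <:].
HB.instance Definition _ (T : finType) :=
  GRing.SubChoice_isSubNmodule.Build (join_set T) (mem (@not_singleton T))
    (nonsingleton T) (@not_singleton_addr_closed T).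

Fact join_set_idem (T : finType) (A : join_set T) : A + A = A.
Proof. exact: setUid. Qed.
Fact nonsingleton_idem (T : finType) (A : nonsingleton T) : A + A = A.
Proof. by apply: val_inj; rewrite raddfD; apply: setUid. Qed.

Section M3.
Variable D : pzSemiRingType.
Hypotheses (D_division : division_semiring D) (D_idem : forall s : D, s + s = s).

Definition cube : lSemiModType D :=
  boolean_semimodule D_division D_idem (@join_set_idem 'I_3).
Definition M3 : lSemiModType D :=
  boolean_semimodule D_division D_idem (@nonsingleton_idem 'I_3).

Fact M3_incl_semilinear : semilinear (val : M3 -> cube).
Proof.
split=> [d A | A B]; last exact: raddfD.
by rewrite /GRing.scale /= /boolean_scale; case: ifP; rewrite ?raddf0.
Qed.

Fact setC1_not_singleton (i : 'I_3) :
  ([set~ i] : join_set 'I_3) \in @not_singleton 'I_3.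
Proof. by rewrite unfold_in /not_singleton cardsC1 card_ord. Qed.

Fact setT_not_singleton : ([set: 'I_3] : join_set 'I_3) \in @not_singleton 'I_3.
Proof. by rewrite unfold_in /not_singleton cardsT card_ord. Qed.

Lemma M3_has_top : exists top : M3, forall m, m + top = top.
Proof.
exists (Nonsingleton setT_not_singleton) => m.
by apply: val_inj; rewrite raddfD; apply: setUT.
Qed.

(** A retraction [r] of the cube onto [M3] is monotone and fixes the pairs, so it sends a singleton
    below both pairs containing it, hence to 0, as [M3] has no singletons. Then the pair of 1 and 2,
    a sum of singletons, would also go to 0. *)
Lemma M3_not_injective : ~ injective_semimodule M3.
Proof.
have incl_inj : injective (linear_of M3_incl_semilinear) by apply: val_inj.
move=> /(_ _ _ _ idfun incl_inj) [r rP].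
pose atom (i : 'I_3) : M3 := Nonsingleton (setC1_not_singleton i).
have r_atom i : r ([set~ i] : join_set 'I_3) = atom i := rP (atom i).
have r_sub (i j : 'I_3) : i != j ->
    (val (r ([set i] : join_set 'I_3)) : {set 'I_3}) \subset [set~ j].
  move=> ij; rewrite -[[set~ j]]/(val (atom j) : {set 'I_3}) -r_atom.
  have -> : ([set~ j] : cube) = ([set i] : join_set 'I_3) + [set~ j].
    by apply/esym/setUidPr; rewrite sub1set !inE.
  by rewrite linearD raddfD /=; apply: subsetUl.
have r1_eq0 (i : 'I_3) : r ([set i] : join_set 'I_3) = 0.
  apply: val_inj; rewrite raddf0.
  have : (val (r ([set i] : join_set 'I_3)) : {set 'I_3}) \subset [set i].
    (* The sets [[set~ j]] with [j] different from [i] intersect in [[set i]]. *)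
    apply/subsetP => j jr; rewrite inE; apply: contraTT jr; rewrite eq_sym => ij.
    by apply/negP => /(subsetP (r_sub i j ij)); rewrite !inE eqxx.
  rewrite subset1 => /orP[/eqP ri | /eqP //].
  have : val (r ([set i] : join_set 'I_3)) \in @not_singleton 'I_3 := valP _.
  by rewrite ri unfold_in /not_singleton cards1.
pose i1 : 'I_3 := inord 1; pose i2 : 'I_3 := inord 2.
have : ([set~ ord0] : cube) =
    ([set i1] : join_set 'I_3) + ([set i2] : join_set 'I_3).
  apply/setP => i; rewrite !inE -!val_eqE /= !inordK //.
  by case: i => [[|[|[|]]]].
move=> /(congr1 r); rewrite linearD !r1_eq0 addr0 r_atom.
move=> /(congr1 val) /setP/(_ i1).
by rewrite /= !inE -val_eqE /= inordK.
Qed.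

End M3.

Theorem mainTheorem10 (D : pzSemiRingType)
    (D_division : division_semiring D)
    (D_idem : forall s : D, s + s = s) :
  (forall M : lSemiModType D, injective_semimodule M -> e_injective M) /\
  (exists M : lSemiModType D, e_injective M /\ ~ injective_semimodule M).
Proof.
split=> [M /(injective_has_top D_division D_idem) [top top_add] | ].
  exact: top_e_injective top_add.
exists (M3 D_division D_idem); split; last exact: M3_not_injective.
by have [top top_add] := M3_has_top D_division D_idem; apply: top_e_injective top_add.
Qed.
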